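(* Let $(L,[-,-]_1)$ and $(L,[-,-]_2)$ be two compatible Leibniz algebras such that the associated ternary Leibniz algebras, with brackets $\{x,y,z\}_i=[x,[y,z]_i]_i$ ($i=1,2$), are compatible. Let $D,D',D'',D''':L\to L$ be linear maps such that $$D''([x,y]_i)=[D(x),y]_i+[x,D'(y)]_i,\qquad D'''([x,y]_i)=[D(x),y]_i+[x,D''(y)]_i$$ for all $x,y\in L$ and $i=1,2$ (in particular $D$ is a generalized derivation of the compatible Leibniz algebra $(L,[-,-]_1,[-,-]_2)$). Then $D$ is a generalized derivation of the compatible ternary Leibniz algebra $\bar L=(L,\{-,-,-\}_1,\{-,-,-\}_2)$.
   Context: Vector spaces are over a field $\mathbb{K}$. A Leibniz algebra is a vector space $L$ with a bilinear map $[-,-]$ such that $[[x,y],z]=[x,[y,z]]+[[x,z],y]$. Two Leibniz brackets on $L$ are compatible if $[[x,y]_1,z]_2+[[x,y]_2,z]_1=[x,[y,z]_1]_2+[x,[y,z]_2]_1+[[x,z]_1,y]_2+[[x,z]_2,y]_1$ for all $x,y,z$; then $(L,[-,-]_1,[-,-]_2)$ is a compatible Leibniz algebra. A ternary Leibniz algebra is a vector space $L$ with a trilinear map $[-,-,-]$ such that $[[x,y,z],t,u]=[x,y,[z,t,u]]+[x,[y,t,u],z]+[[x,t,u],y,z]$. For a Leibniz algebra, $\{x,y,z\}=[x,[y,z]]$ is a ternary Leibniz bracket (the associated ternary Leibniz algebra). Two ternary Leibniz brackets on $L$ are compatible, making $L$ a compatible ternary Leibniz algebra, if $$[[x,y,z]_1,t,u]_2+[[x,y,z]_2,t,u]_1=[x,y,[z,t,u]_1]_2+[x,y,[z,t,u]_2]_1+[x,[y,t,u]_1,z]_2+[x,[y,t,u]_2,z]_1+[[x,t,u]_1,y,z]_2+[[x,t,u]_2,y,z]_1.$$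 A linear map $D$ on a ternary Leibniz algebra $(L,[-,-,-])$ is a generalized derivation if there exist linear maps $D_1,D_2,D_3\in\mathrm{End}(L)$ with $D_3([x,y,z])=[D(x),y,z]+[x,D_1(y),z]+[x,y,D_2(z)]$ for all $x,y,z\in L$. On a Leibniz algebra, $D$ is a generalized derivation if there exist linear $D',D''$ with $D''([x,y])=[D(x),y]+[x,D'(y)]$. Convention: an operator on a compatible (ternary) Leibniz algebra is a linear map that is an operator of the given type for both brackets. *)

(* Defs.v *)
From HB Require Import structures.
From mathcomp Require Import all_boot all_algebra.

Set Implicit Arguments.
Unset Strict Implicit.
Unset Printing Implicit Defensive.

Import GRing.Theory.
Local Open Scope ring_scope.

Section Leibniz.
Variables (K : fieldType) (L : lmodType K).

Definition leibniz_identity (b : L -> L -> L) : Prop :=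
  forall x y z, b (b x y) z = b x (b y z) + b (b x z) y.

Record leibnizBracket := LeibnizBracket {
  leibniz_fun :> {bilinear L -> L -> L};
  leibnizP : leibniz_identity leibniz_fun
}.

Definition leibniz_compatible (b1 b2 : L -> L -> L) : Prop :=
  forall x y z,
    b2 (b1 x y) z + b1 (b2 x y) z
    = b2 x (b1 y z) + b1 x (b2 y z) + b2 (b1 x z) y + b1 (b2 x z) y.

Definition trilinear (t : L -> L -> L -> L) : Prop :=
  [/\ forall y z, linear (fun x => t x y z),
      forall x z, linear (fun y => t x y z)
    & forall x y, linear (fun z => t x y z)].

Definition ternary_leibniz_identity (t : L -> L -> L -> L) : Prop :=
  forall x y z u v,
    t (t x y z) u v = t x y (t z u v) + t x (t y u v) z + t (t x u v) y z.

Record ternaryBracket := TernaryBracket {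
  ternary_fun :> L -> L -> L -> L;
  ternary_trilinear : trilinear ternary_fun;
  ternaryP : ternary_leibniz_identity ternary_fun
}.

Definition ternary_compatible (t1 t2 : L -> L -> L -> L) : Prop :=
  forall x y z u v,
    t2 (t1 x y z) u v + t1 (t2 x y z) u v
    = t2 x y (t1 z u v) + t1 x y (t2 z u v)
      + t2 x (t1 y u v) z + t1 x (t2 y u v) z
      + t2 (t1 x u v) y z + t1 (t2 x u v) y z.

Record compatibleTernary := CompatibleTernary {
  ternary1 : ternaryBracket;
  ternary2 : ternaryBracket;
  ternary_compatibleP : ternary_compatible ternary1 ternary2
}.

Definition assoc_ternary_fun (b : L -> L -> L) : L -> L -> L -> L :=
  fun x y z => b x (b y z).

Lemma assoc_ternary_trilinear (b : leibnizBracket) :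
  trilinear (assoc_ternary_fun b).
Proof.
rewrite /assoc_ternary_fun.
by split=> u v a x y; rewrite ?(linearPl, linearPr).
Qed.

Lemma assoc_ternary_leibniz (b : leibnizBracket) :
  ternary_leibniz_identity (assoc_ternary_fun b).
Proof.
by move=> x y z u v; rewrite /assoc_ternary_fun !(leibnizP b _ _ (b u v)) linearDr.
Qed.

Definition assoc_ternary (b : leibnizBracket) : ternaryBracket :=
  TernaryBracket (assoc_ternary_trilinear b) (assoc_ternary_leibniz b).

Definition is_ternary_generalized_derivation
    (t : ternaryBracket) (D : {linear L -> L}) : Prop :=
  exists D1 D2 D3 : {linear L -> L},
    forall x y z, D3 (t x y z) = t (D x) y z + t x (D1 y) z + t x y (D2 z).

(* The witnesses D1, D2, D3 may depend on the bracket: an operator on a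
   compatible algebra is one that has the given type for each bracket. *)
Definition is_compatible_ternary_generalized_derivation
    (T : compatibleTernary) (D : {linear L -> L}) : Prop :=
  is_ternary_generalized_derivation (ternary1 T) D
  /\ is_ternary_generalized_derivation (ternary2 T) D.

End Leibniz.

(* Main.v *)
Require Import Defs.
From HB Require Import structures.
From mathcomp Require Import all_boot all_algebra.

Set Implicit Arguments.
Unset Strict Implicit.
Unset Printing Implicit Defensive.

Import GRing.Theory.
Local Open Scope ring_scope.

(** Applying the rule for [D'''] to the outer bracket of [b x (b y z)] leaves
    the term [b x (D'' (b y z))], which the rule for [D''] expands; hence the
    witnesses are [D], [D'] and [D''']. *)
Lemma assoc_ternary_generalized_derivation (K : fieldType) (L : lmodType K)
    (b : leibnizBracket L) (D D' D'' D''' : {linear L -> L})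
    (hD'' : forall x y, D'' (b x y) = b (D x) y + b x (D' y))
    (hD''' : forall x y, D''' (b x y) = b (D x) y + b x (D'' y)) :
  is_ternary_generalized_derivation (assoc_ternary b) D.
Proof.
exists D, D', D''' => x y z /=.
by rewrite /assoc_ternary_fun hD''' hD'' linearDr addrA.
Qed.

Theorem proposition3p3 (K : fieldType) (L : lmodType K)
    (b1 b2 : leibnizBracket L)
    (compat2 : leibniz_compatible b1 b2)
    (compat3 : ternary_compatible (assoc_ternary b1) (assoc_ternary b2))
    (D D' D'' D''' : {linear L -> L})
    (hD''1 : forall x y, D'' (b1 x y) = b1 (D x) y + b1 x (D' y))
    (hD''2 : forall x y, D'' (b2 x y) = b2 (D x) y + b2 x (D' y))
    (hD'''1 : forall x y, D''' (b1 x y) = b1 (D x) y + b1 x (D'' y))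
    (hD'''2 : forall x y, D''' (b2 x y) = b2 (D x) y + b2 x (D'' y)) :
  is_compatible_ternary_generalized_derivation (CompatibleTernary compat3) D.
Proof.
split.
  exact: assoc_ternary_generalized_derivation hD''1 hD'''1.
exact: assoc_ternary_generalized_derivation hD''2 hD'''2.
Qed.
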